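(* Let $t,n$ be positive integers with $t\ge 2n+1$, and let $C_t$ be the cycle with vertex set $\mathbb{Z}_t$ and edges $\{i,i+1\}$ for $i\in\mathbb{Z}_t$. If $\mathcal{F}$ is a collection of $n$ (not necessarily distinct) $2$-jump independent $n$-sets of $C_t$, then $\mathcal{F}$ has a rainbow independent $n$-set in $C_t$.
   Context: An ordered set $I=(a_1,\dots,a_n)$ of vertices of $C_t$ is a $2$-jump independent $n$-set of $C_t$ if $a_{i+1}-a_i\equiv 2 \pmod t$ for all $1\le i\le n-1$ (for $t\ge 2n+1$ this is an independent set of size $n$). For a collection $\mathcal{F}=(F_1,\dots,F_k)$ of sets, a rainbow set is a set $\{x_{i_1},\dots,x_{i_m}\}$ of $m$ distinct elements with distinct indices $i_1<\dots<i_m$ in $[k]$ and $x_{i_j}\in F_{i_j}$; a rainbow independent $n$-set is a rainbow set of size $n$ that is an independent set of $C_t$. *)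

(* Defs.v *)
From mathcomp Require Import all_boot all_order all_algebra.

Set Implicit Arguments.
Unset Strict Implicit.
Unset Printing Implicit Defensive.

Import GRing.Theory.
Local Open Scope ring_scope.

(* MathComp's ['Z_t] is the ring of integers mod t only for 1 < t; below it is
   used with 2 * n + 1 <= t and 0 < n, hence 3 <= t. *)
Definition cycle_adj (t : nat) : rel 'Z_t :=
  fun x y => (y == x + 1) || (x == y + 1).

Definition independent (V : finType) (e : rel V) (X : {set V}) : Prop :=
  {in X &, forall x y, ~~ e x y}.

(* The ordered set (a_1, ..., a_n) is a duplicate-free tuple, indexed from 0. *)
Definition two_jump_independent (t n : nat) (a : n.-tuple 'Z_t) : Prop :=
  uniq a /\
  forall i : nat, (i.+1 < n)%N -> nth 0 a i.+1 - nth 0 a i = 2%:R.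

Definition rainbow_set (V : finType) (k : nat) (F : 'I_k -> {set V})
    (X : {set V}) : Prop :=
  exists (m : nat) (i : 'I_m -> 'I_k) (x : 'I_m -> V),
    [/\ forall j j' : 'I_m, (j < j')%N -> (i j < i j')%N,
        injective x,
        forall j : 'I_m, x j \in F (i j)
      & X = [set x j | j : 'I_m]].

Definition rainbow_independent_set (V : finType) (e : rel V) (k : nat)
    (F : 'I_k -> {set V}) (n : nat) (X : {set V}) : Prop :=
  [/\ rainbow_set F X, #|X| = n & independent e X].

(* Main.v *)
(** A 2-jump n-set is determined by its first element a_i, and the task is to
    choose offsets k_i < n so that the points a_i + 2 k_i are pairwise at
    distance at least 2 on the cycle.

    If t = 2n+1, halve the cycle: the sets become intervals of length n, with
    starts v_0 <= ... <= v_(n-1) in [0, 2n].  The n numbers v_r - r miss some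
    residue c mod n+1.  Moving the r-th start forward to the next value with
    v_r + k_r - r = c - 1 mod n+1 costs at most n-1 steps, precisely because c
    is missed.  Since v_r - r drops by at most 1 at each step, it cannot cross a
    level congruent to c downwards, and over all r it rises by at most n+1; so
    the chosen points form n consecutive points mod 2n+1, that is, an
    independent 2-jump set.

    If t > 2n+1, shorten the cycle by deleting a vertex, solve the problem for
    the same n and reinsert the vertex: the points whose set crosses the deleted
    place before reaching them keep their position, the others move up by 1.  A
    conflict can only come from a moved point q and a kept point q + 2, and then
    the two sets can exchange their points.  Exchanges terminate because the
    sum of the kept points decreases. *)
Require Import Defs.
From mathcomp Require Import all_boot all_order all_algebra.
From mathcomp Require Import perm zify.

Set Implicit Arguments.
Unset Strict Implicit.
Unset Printing Implicit Defensive.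

Definition spaced (t x y : nat) : bool :=
  ((x + 2 <= y) && (y + 2 <= x + t)) || ((y + 2 <= x) && (x + 2 <= y + t)).

Lemma spacedC t x y : spaced t x y = spaced t y x.
Proof. by rewrite /spaced orbC. Qed.

Definition choice_spaced (t n : nat) (a k : 'I_n -> nat) : Prop :=
  (forall i, k i < n) /\
  forall i j, i != j -> spaced t ((a i + 2 * k i) %% t) ((a j + 2 * k j) %% t).

Lemma modn_lt_double (t s : nat) :
  s < t + t -> s %% t = if s < t then s else s - t.
Proof.
move=> lt_s; case: ltnP => [/modn_small // | le_ts].
by rewrite -{1}(subnK le_ts) modnDr modn_small //; lia.
Qed.

Lemma missed_residue (n : nat) (g : nat -> nat) :
  exists2 c, c <= n & forall r, r < n -> g r %% n.+1 != c.
Proof.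
pose f (r : 'I_n) : 'I_n.+1 := inord (g r %% n.+1).
have /subsetPn[c _ cNf] : ~~ ([set: 'I_n.+1] \subset [set f r | r in 'I_n]).
  apply/negP => /subset_leq_card; rewrite cardsT card_ord => le_card.
  have := leq_trans le_card (leq_imset_card f 'I_n).
  by rewrite card_ord ltnn.
exists c; first by rewrite -ltnS.
move=> r lt_r; apply: contra cNf => /eqP gr_c.
apply/imsetP; exists (Ordinal lt_r) => //.
by apply: val_inj; rewrite /f /= gr_c inordK.
Qed.

(** Modulo [2 * n + 1] the extra [n.+1] is [-n], so both outcomes fit one block of [n] consecutive
    points. *)
Lemma sorted_block_choice (n : nat) (v : nat -> nat) :
    (forall r, r.+1 < n -> v r <= v r.+1) ->
    (forall r, r < n -> v r <= 2 * n) ->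
  exists2 k : nat -> nat, (forall r, r < n -> k r < n) &
    forall r s, r < s -> s < n ->
      v s + k s = v r + k r + (s - r) \/
      v s + k s = v r + k r + (s - r) + n.+1.
Proof.
move=> v_mono v_max.
(* This is [v r - r], raised by [n] so that the subtraction does not truncate. *)
pose g r := v r + (n - r).
have [c le_cn g_c] := missed_residue n g.
(* The least [k] with [g r + k + 1] congruent to [c]; it is not [n], as [g r] itself would then be
   congruent to [c]. The number of the level reached is [q r]. *)
pose k r := if g r %% n.+1 < c then c - 1 - g r %% n.+1
            else c + n - g r %% n.+1.
pose q r := if g r %% n.+1 < c then g r %/ n.+1 else (g r %/ n.+1).+1.
have k_lt r : r < n -> k r < n.
  by move=> lt_r; rewrite /k; move: (g_c r lt_r); case: (ltnP (_ %% _) c); lia.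
have gk r : r < n -> g r + k r + 1 = q r * n.+1 + c.
  move=> lt_r; rewrite /k /q {1}(divn_eq (g r) n.+1).
  have := ltn_pmod (g r) (ltn0Sn n); move: (g_c r lt_r).
  move: (g r %% _) (g r %/ _) => z y.
  by case: (ltnP z c); rewrite ?mulSn; move: (y * _); lia.
clearbody k q.
have q_step r : r.+1 < n -> q r <= q r.+1.
  move=> lt_r; rewrite leqNgt; apply/negP => lt_q.
  have := gk _ lt_r; have := gk _ (ltnW lt_r); have := k_lt _ (ltnW lt_r).
  have := v_mono _ lt_r; rewrite /g.
  have := leq_mul lt_q (leqnn n.+1); rewrite mulSn; lia.
have q_mono r s : r <= s -> s < n -> q r <= q s.
  elim: s => [|s IHs]; first by rewrite leqn0 => /eqP->.
  rewrite leq_eqVlt => /predU1P[-> //|]; rewrite ltnS => le_rs lt_s.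
  exact: leq_trans (IHs le_rs (ltnW lt_s)) (q_step _ lt_s).
have q_max r s : r < s -> s < n -> q s <= (q r).+1.
  move=> lt_rs lt_s; have n_gt0 : 0 < n by lia.
  have lt_p : n.-1 < n by rewrite prednK.
  apply: (leq_trans (q_mono _ n.-1 _ _)); [lia | lia |].
  apply: (@leq_trans (q 0).+1); last by rewrite ltnS q_mono //; lia.
  rewrite leqNgt; apply/negP => lt_q.
  have := gk _ lt_p; have := gk _ n_gt0; have := k_lt _ lt_p.
  have := v_max _ lt_p; rewrite /g.
  have := leq_mul lt_q (leqnn n.+1); rewrite !mulSn; lia.
exists k => // r s lt_rs lt_s; have lt_r := ltn_trans lt_rs lt_s.
have := gk _ lt_r; have := gk _ lt_s; rewrite /g.
have := q_max _ _ lt_rs lt_s; rewrite leq_eqVlt ltnS => /predU1P[->|q_le].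
  by rewrite mulSn; lia.
by have -> : q s = q r; [have := q_mono _ _ (ltnW lt_rs) lt_s; lia | lia].
Qed.

Lemma tight_choice (n : nat) (a : 'I_n -> nat) :
  exists k, choice_spaced (2 * n + 1) a k.
Proof.
set t := 2 * n + 1.
case: n @t a => [|n] t a; first by exists (fun=> 0); split=> -[].
set m := n.+1 in t a *.
(* [m.+1] is the inverse of 2 modulo [t = 2 * m + 1]. *)
pose h i := (a i * m.+1) %% t.
pose s := sort (relpre h leq) (enum 'I_m).
have size_s : size s = m by rewrite size_sort size_enum_ord.
have s_sorted : sorted (relpre h leq) s.
  by apply: sort_sorted => i j; apply: leq_total.
have mem_s i : i \in s by rewrite mem_sort mem_enum.
pose v r := h (nth ord0 s r).
have v_mono r : r.+1 < m -> v r <= v r.+1.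
  move=> lt_r; rewrite -size_s in lt_r.
  exact: (elimT (sortedP ord0) s_sorted r lt_r).
have v_max r : r < m -> v r <= 2 * m.
  by move=> _; have : v r < t by [rewrite ltn_mod /t addn1]; rewrite /t; lia.
have [k k_lt vk] := sorted_block_choice v_mono v_max.
have idx_lt i : index i s < m by have := mem_s i; rewrite -index_mem size_s.
have v_idx i : v (index i s) = h i by rewrite /v nth_index.
have double i l : (a i + 2 * l) %% t = (2 * (h i + l)) %% t.
  rewrite mulnDr -modnDml -[in RHS]modnDml; congr ((_ + _) %% t).
  rewrite /h modnMmr mulnCA.
  have -> : 2 * m.+1 = t + 1 by rewrite /t; lia.
  by rewrite mulnDr muln1 modnMDl.
exists (fun i => k (index i s)); split=> [i|]; first exact: k_lt.
suff lt_spaced i j : index i s < index j s ->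
    spaced t ((a i + 2 * k (index i s)) %% t) ((a j + 2 * k (index j s)) %% t).
  move=> i j neq_ij; have [/lt_spaced //|/lt_spaced|] := ltngtP (index i s) (index j s).
    by rewrite spacedC.
  by move/(index_inj ord0 (mem_s i) (mem_s j)) => eq_ij; rewrite eq_ij eqxx in neq_ij.
move=> lt_ij; rewrite !double -!v_idx.
have := vk _ _ lt_ij (idx_lt j); have := idx_lt j.
set x := v (index i s) + _; set y := v (index j s) + _ => ltj xy.
(* As [2 * m.+1 = t + 1], doubling turns the extra [m.+1] into 1 modulo [t]. The indices differ by
   at most [m - 1], which leaves [e <= t - 2]. *)
have [e e_range ->] : exists2 e, (2 <= e) && (e + 2 <= t) &
    (2 * y) %% t = (2 * x + e) %% t.
  case: xy => ->; [exists (2 * (index j s - index i s))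
                  | exists (2 * (index j s - index i s) + 1)].
  - by rewrite /t; lia.
  - by congr (_ %% _); lia.
  - by rewrite /t; lia.
  - by rewrite -[RHS]modnDr; congr (_ %% _); rewrite /t; lia.
rewrite -modnDml; have : (2 * x) %% t < t by rewrite ltn_mod /t addn1.
move: ((2 * x) %% t) => z lt_z.
by rewrite modn_lt_double /spaced; [case: ltnP | ]; lia.
Qed.

(* The deleted vertex is 0, so a start [a i > 0] is renumbered as [(a i).-1]; a
   start at 0 itself is placed at the next vertex, which is also numbered 0, and
   counts as having crossed. *)
Lemma lengthen_cycle (t n : nat) (a : 'I_n -> nat) :
    2 * n + 1 <= t -> (forall i, a i <= t) ->
    (exists k, choice_spaced t (fun i => (a i).-1) k) ->
  exists k, choice_spaced t.+1 a k.
Proof.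
move=> le_t a_le [k0].
pose pos (k : 'I_n -> nat) i := ((a i).-1 + 2 * k i) %% t.
pose crosses (k : 'I_n -> nat) i := (a i == 0) || (t <= (a i).-1 + 2 * k i).
have posE k i : k i < n -> pos k i =
    if (a i).-1 + 2 * k i < t then (a i).-1 + 2 * k i else (a i).-1 + 2 * k i - t.
  by move=> k_lt; rewrite /pos modn_lt_double //; have := a_le i; lia.
have [N] := ubnP (\sum_(i | crosses k0 i) pos k0 i).
elim: N k0 => // N IHN k; rewrite ltnS => le_N [k_lt k_sp].
case: (boolP [exists i, exists j,
    [&& crosses k i, ~~ crosses k j & pos k i == pos k j + 2]]) => [|no_bad].
  case/existsP=> i /existsP[j /and3P[ci cj /eqP pos_ij]].
  have neq_ij : i != j by apply: contra cj => /eqP <-.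
  (* One jump back for [i] and one forward for [j] swap their positions. *)
  pose k' l := if l == i then (k i).-1 else if l == j then (k j).+1 else k l.
  have k'i : k' i = (k i).-1 by rewrite /k' eqxx.
  have k'j : k' j = (k j).+1 by rewrite /k' eq_sym (negPf neq_ij) eqxx.
  have k'E l : l != i -> l != j -> k' l = k l.
    by rewrite /k' => /negPf-> /negPf->.
  (* Since [pos k i >= 2], the set [i] can step back and still counts as crossing. A crossing point
     is at most [2 * n - 2], so [2 * k j <= pos k j <= 2 * n - 4] and [j] has a jump left; it ends
     at [pos k i < t], hence does not cross. *)
  have [[k'i_lt k'j_lt c'i c'j] [pos'i pos'j]] : [/\ k' i < n, k' j < n,
      crosses k' i & ~~ crosses k' j] /\ pos k' i = pos k j /\ pos k' j = pos k i.
    move: (k_lt i) (k_lt j) (a_le i) (a_le j) => ki kj ai aj.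
    have -> : pos k' j = ((a j).-1 + 2 * (k j).+1) %% t by rewrite /pos k'j.
    have -> : pos k' i = ((a i).-1 + 2 * (k i).-1) %% t by rewrite /pos k'i.
    move: ci cj pos_ij; rewrite !posE // /crosses k'i k'j.
    rewrite !modn_lt_double; [|lia..].
    move: (a i) (a j) (k i) (k j) ki kj ai aj => ai aj ki kj lt_ki lt_kj le_ai le_aj.
    case: (ltnP (aj.-1 + 2 * kj) t); case: (ltnP (ai.-1 + 2 * ki) t);
      case: (ltnP (aj.-1 + 2 * kj.+1) t); case: (ltnP (ai.-1 + 2 * ki.-1) t);
      by move=> *; do !split; lia.
  have pos'E l : l != i -> l != j -> pos k' l = pos k l.
    by move=> li lj; rewrite /pos k'E.
  have crosses'E l : crosses k' l = crosses k l.
    have [-> | li] := eqVneq l i; first by rewrite c'i ci.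
    have [-> | lj] := eqVneq l j; first by rewrite (negPf c'j) (negPf cj).
    by rewrite /crosses k'E.
  apply: (IHN k').
    apply: leq_trans le_N; rewrite (eq_bigl _ _ crosses'E).
    rewrite (bigD1 i) //= [X in _ < X](bigD1 i) //= pos'i pos_ij.
    rewrite -addSn; apply: leq_add; first by rewrite addn2.
    apply: leq_sum => l /andP[wl li]; rewrite pos'E //.
    by apply: contra cj => /eqP <-.
  split=> [l|l m neq_lm].
    have [-> // | li] := eqVneq l i; have [-> // | lj] := eqVneq l j.
    by rewrite k'E.
  have pos_tperm r : pos k' r = pos k (tperm i j r).
    by case: tpermP => [->|->|/eqP ri /eqP rj] //; apply: pos'E.
  have := k_sp (tperm i j l) (tperm i j m).
  rewrite (inj_eq perm_inj) => /(_ neq_lm).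
  by rewrite -/(pos k _) -/(pos k (tperm i j m)) -!pos_tperm.
exists k; split=> // i j neq_ij.
have newE l : (a l + 2 * k l) %% t.+1 = pos k l + ~~ crosses k l.
  have := k_lt l; have := a_le l => al kl.
  rewrite modn_lt_double ?posE // /crosses; last by lia.
  by case: (ltnP (a l + _)); case: (ltnP ((a l).-1 + _)); lia.
have gap l m : crosses k l -> ~~ crosses k m -> pos k l != pos k m + 2.
  move=> wl wm; apply: contra no_bad => eq_lm.
  by apply/existsP; exists l; apply/existsP; exists m; rewrite wl wm.
(* Only the gap from a moved point up to a kept one shrinks, by 1, and [gap] excludes that it was
   2. *)
move: (k_sp _ _ neq_ij) (gap i j) (gap j i); rewrite -/(pos k i) -/(pos k j) !newE /spaced.
by case: (crosses k i); case: (crosses k j) => /=; lia.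
Qed.

Lemma spaced_choice (t n : nat) (a : 'I_n -> nat) :
    2 * n + 1 <= t -> (forall i, a i < t) ->
  exists k, choice_spaced t a k.
Proof.
move=> le_t; rewrite -(subnK le_t); elim: (t - _) a => [|d IHd] a a_lt.
  exact: tight_choice.
rewrite addSn; apply: lengthen_cycle; [exact: leq_addl | exact: a_lt |].
by apply: IHd => i; have := a_lt i; lia.
Qed.

Section CycleTranslation.

Import GRing.Theory.
Local Open Scope ring_scope.

Lemma nth_two_jump (t n : nat) (a : n.-tuple 'Z_t) (k : nat) :
  two_jump_independent a -> (k < n)%N ->
  nth 0 a k = nth 0 a 0 + (2 * k)%:R.
Proof.
case=> _ jump; elim: k => [|k IHk] lt_k; first by rewrite addr0.
rewrite -[LHS](subrK (nth 0 a k)) jump // IHk 1?ltnW //.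
by rewrite mulnS natrD addrCA.
Qed.

(** The case [x == y] is included because [independent] also tests a vertex against itself. *)
Lemma spaced_nonadj (t : nat) (x y : 'Z_t) : (3 <= t)%N ->
  (x == y) || spaced t x y -> ~~ cycle_adj x y.
Proof.
move=> t_gt2.
have val_succ (z : 'Z_t) : z + 1 = (z.+1 %% t)%N :> nat.
  by rewrite -{1}[z]natr_Zp natr1; apply: val_Zp_nat; apply: ltnW.
have lt_Z (z : 'Z_t) : (z < t)%N by rewrite -[ltnRHS](Zp_cast (ltnW t_gt2)).
move=> eq_or_sp; have {eq_or_sp}: (x == y :> nat) || spaced t x y by [].
move: (lt_Z x) (lt_Z y) => lt_x lt_y sp.
apply/norP; split; apply/eqP => /(congr1 (@nat_of_ord _)); rewrite val_succ;
  move: sp; rewrite modn_lt_double /spaced; try lia; case: ltnP; lia.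
Qed.

End CycleTranslation.

Theorem theorem1p8 (t n : nat) (n_gt0 : (0 < n)%N) (le_t : (2 * n + 1 <= t)%N)
    (F : 'I_n -> n.-tuple 'Z_t)
    (F_jump : forall i : 'I_n, two_jump_independent (F i)) :
  exists X : {set 'Z_t},
    rainbow_independent_set (@cycle_adj t) (fun i => [set x in F i]) n X.
Proof.
have t_gt1 : 1 < t by lia.
have [k [k_lt k_sp]] : exists k, choice_spaced t (fun i => nth 0%R (F i) 0 : nat) k.
  by apply: spaced_choice => // i; rewrite -[ltnRHS](Zp_cast t_gt1).
pose x i := nth 0%R (F i) (k i).
have xE i : x i = (nth 0%R (F i) 0 + 2 * k i) %% t :> nat.
  rewrite /x (nth_two_jump (F_jump i)) // -{1}[nth _ _ 0]natr_Zp -GRing.natrD.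
  exact: val_Zp_nat.
have x_sp i j : i != j -> spaced t (x i) (x j) by rewrite !xE; apply: k_sp.
have x_inj : injective x.
  move=> i j eq_x; apply/eqP/negPn/negP => /x_sp.
  by rewrite eq_x /spaced; lia.
exists [set x j | j : 'I_n]; split.
- exists n, id, x; split=> // j.
  by rewrite inE mem_nth // size_tuple.
- by rewrite card_imset // card_ord.
- move=> _ _ /imsetP[i _ ->] /imsetP[j _ ->].
  apply: spaced_nonadj; first by lia.
  by have [-> | /x_sp->] := eqVneq i j; rewrite ?eqxx ?orbT.
Qed.
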